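(* Let $K$ be a non-Archimedean local field with residue field of cardinality $q$ and normalized absolute value $|\cdot|_K$, let $\alpha>0$, $u_0\in\mathbb R$, and let $f:\ q^{\mathbb Z}\times\mathbb R\to\mathbb R$ satisfy the following conditions: (i) with some constants $M,F>0$, $|f(|t|_K,x)|\le M$ and $|f(|t|_K,x)-f(|t|_K,y)|\le F|x-y|$ for all $t\in K\setminus\{0\}$ and $x,y\in\mathbb R$; (ii) $|f(q^l,x)-f(q^l,y)|\le F_l|x-y|$ for all $x,y\in\mathbb R$, $l\in\mathbb Z$, where $0<F_l<q^{-\alpha l}$ for each $l\in\mathbb Z$; (iii) there are constants $C>0$ and $\beta>\alpha$ such that $|f(q^l,x)|\le Cq^{-\beta l}$ for all integers $l\ge1$ and all $x\in\mathbb R$. Then the mild solution $u=u(|t|_K)$, $t\in K$, of the Cauchy problem for the equation $D^\alpha u=f(\cdot,u)$ with the initial condition $u(0)=u_0$, obtained by the iteration process with subsequent continuation (as described in the context), satisfies the equation $$(D^\alpha u)(|t|_K)=f(|t|_K,u(|t|_K)),\qquad 0\ne t\in K.$$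
   Context: $K$ is a non-Archimedean local field (a non-discrete totally disconnected locally compact topological field); the normalized absolute value takes the values $0$ and $q^n$, $n\in\mathbb Z$. $dx$ is the Haar measure on the additive group of $K$ normalized so that the ring of integers $O=\{x\in K:|x|_K\le 1\}$ has measure $1$. A radial function is a function of the form $x\mapsto u(|x|_K)$; it is identified with the function $|x|_K\mapsto u(|x|_K)$ on $q^{\mathbb Z}$ (together with its value $u(0)$ at the origin). The operator $D^\alpha$ (Vladimirov's operator) is $$(D^\alpha u)(x)=\theta_\alpha\int_K|y|_K^{-\alpha-1}[u(x-y)-u(x)]\,dy,\qquad \theta_\alpha=\frac{1-q^\alpha}{1-q^{-\alpha-1}} .$$ If a radial function $u$ satisfies $\sum_{k=-\infty}^m q^k|u(q^k)|<\infty$ and $\sum_{l=m}^\infty q^{-\alpha l}|u(q^l)|<\infty$ for some $m\in\mathbb Z$, then for every $n\in\mathbb Z$ this expression exists for $|x|_K=q^n$, depends only on $|x|_K$, and equals $$(D^\alpha u)(q^n)=\theta_\alpha\Big(1-\frac1q\Big)q^{-(\alpha+1)n}\sum_{k=-\infty}^{n-1}q^ku(q^k)+q^{-\alpha n-1}\frac{q^\alpha+q-2}{1-q^{-\alpha-1}}u(q^n)+\theta_\alpha\Big(1-\frac1q\Big)\sum_{l=n+1}^\infty q^{-\alpha l}u(q^l).$$ The operator $I^\alpha$ acts on radial functions $\varphi$ with $\sum_{k\le m}\max(q^k,q^{\alpha k})|\varphi(q^k)|<\infty$ (if $\alpha\ne1$), respectively $\sum_{k\le m}|k|q^k|\varphi(q^k)|<\infty$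 (if $\alpha=1$), for some $m\in\mathbb Z$, by $(I^\alpha\varphi)(0)=0$ and, for $x\ne0$, $$(I^\alpha\varphi)(|x|_K)=q^{-\alpha}|x|_K^\alpha\varphi(|x|_K)+\frac{1-q^{-\alpha}}{1-q^{\alpha-1}}\int_{|y|_K<|x|_K}\big(|x|_K^{\alpha-1}-|y|_K^{\alpha-1}\big)\varphi(|y|_K)\,dy,\quad\alpha\neq1,$$ $$(I^1\varphi)(|x|_K)=q^{-1}|x|_K\varphi(|x|_K)+\frac{1-q}{q\log q}\int_{|y|_K<|x|_K}\big(\log|x|_K-\log|y|_K\big)\varphi(|y|_K)\,dy .$$ A mild solution of the Cauchy problem is a solution $u$ of the integral equation $$u(|t|_K)=u_0+I^\alpha\big[f(|\cdot|_K,u(|\cdot|_K))\big](|t|_K).\qquad( * )$$ Under (i) and (ii), the mild solution obtained by the iteration process with subsequent continuation is constructed as follows. Iteration: starting from the constant function $u_0$, put $u_k(|t|_K)=u_0+I^\alpha[f(|\cdot|_K,u_{k-1}(|\cdot|_K))](|t|_K)$, $k\ge1$; for a sufficiently small $N\in\mathbb Z$ the sequence $u_k$ converges uniformly on the ball $\{|t|_K\le q^N\}$, and $u$ is its limit there; this limit is a solution of $( * )$ on that ball. Continuation: successively for $l=N,N+1,N+2,\dots$, the value $u(q^{l+1})\in\mathbb R$ is determined from the already known values $u(q^j)$, $j\le l$, as the unique solution of equation $( * )$ at $|t|_K=q^{l+1}$, that is, of $$u(q^{l+1})=u_0+v_0^{(l)}+q^{\alpha l}f(q^{l+1},u(q^{l+1})),$$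 where $$v_0^{(l)}=\frac{1-q^{-\alpha}}{1-q^{\alpha-1}}\int_{|y|_K\le q^l}\big(q^{(l+1)(\alpha-1)}-|y|_K^{\alpha-1}\big)f(|y|_K,u(|y|_K))\,dy\quad\text{if }\alpha\ne1,$$ $$v_0^{(l)}=\frac{1-q}{q\log q}\int_{|y|_K\le q^l}\big(\log q^{l+1}-\log|y|_K\big)f(|y|_K,u(|y|_K))\,dy\quad\text{if }\alpha=1.$$ *)

(* Defs.v *)
From HB Require Import structures.
From mathcomp Require Import all_boot all_order all_algebra.
From mathcomp Require Import all_classical all_reals all_analysis.
Set Implicit Arguments.
Unset Strict Implicit.
Unset Printing Implicit Defensive.
Import Order.TTheory GRing.Theory Num.Theory numFieldNormedType.Exports.
Local Open Scope classical_set_scope.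
Local Open Scope card_scope.
Local Open Scope ring_scope.

HB.mixin Record TopologicalZmodule_isTopologicalField K
    & GRing.Field K & TopologicalZmodule K := {
  fmul_continuous : continuous (fun x : K * K => x.1 * x.2) ;
  finv_continuous : forall x : K, x != 0 -> {for x, continuous (@GRing.inv K)}
}.

#[short(type="topologicalFieldType")]
HB.structure Definition TopologicalField :=
  {K of GRing.Field K & TopologicalZmodule K
      & TopologicalZmodule_isTopologicalField K}.

Record nonarch_local_field (K : topologicalFieldType) : Prop := {
  nlf_nondiscrete : ~ open [set (0 : K)] ;
  nlf_totally_disconnected : totally_disconnected [set: K] ;
  nlf_locally_compact : locally_compact [set: K]
}.

(* The residue field O/P, with O = {N <= 1} and P = {N < 1}, is counted as the
   set of cosets x + P, x in O. *)
Record normalized_abs (R : realType) (K : topologicalFieldType) (q : nat)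
    (N : K -> R) : Prop := {
  nabs_ge0 : forall x, 0 <= N x ;
  nabs_eq0 : forall x, N x = 0 <-> x = 0 ;
  nabs_mul : forall x y, N (x * y) = N x * N y ;
  nabs_ultra : forall x y, N (x + y) <= Num.max (N x) (N y) ;
  nabs_nbhs : forall (x : K) (A : set K), nbhs x A <->
    exists2 e : R, 0 < e & [set y | N (y - x) < e] `<=` A ;
  nabs_residue :
    [set [set y | N (y - x) < 1] | x in [set x | N x <= 1]] #= `I_q ;
  nabs_values :
    [set N x | x in [set x | x != 0]] = [set q%:R ^ n | n in [set: int]]
}.

(* An alias of K carrying the Borel sigma-algebra; the base point is only there
   because the library defines measurable types over pointed types. *)
Definition borel (K : topologicalFieldType) : Type := K.

HB.instance Definition _ (K : topologicalFieldType) := Choice.on (borel K).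
HB.instance Definition _ (K : topologicalFieldType) :=
  isPointed.Build (borel K) (0 : K).
HB.instance Definition _ (K : topologicalFieldType) :=
  @isMeasurable.Build (sigma_display (@open K)) (borel K) <<s @open K >>
    (@sigma_algebra0 _ setT (@open K)) (@sigma_algebraC (borel K) (@open K))
    (@sigma_algebra_bigcup _ setT (@open K)).

(* Regularity is not listed: K is second countable, so it is automatic. *)
Record normalized_haar (R : realType) (K : topologicalFieldType) (N : K -> R)
    (mu : {measure set (borel K) -> \bar R}) : Prop := {
  haar_invariant : forall (a : K) (A : set (borel K)), measurable A ->
    mu [set a + x | x in (A : set K)] = mu A ;
  haar_compact : forall A : set K, compact A -> (mu A < +oo)%E ;
  haar_integers : mu [set x : K | N x <= 1] = 1%E
}.

Section Operators.
Variables (R : realType) (K : topologicalFieldType) (q : nat) (N : K -> R).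
Variables (mu : {measure set (borel K) -> \bar R}) (alpha : R).

Definition theta : R := (1 - q%:R `^ alpha) / (1 - q%:R `^ (- alpha - 1)).

Definition vladimirov_integrand (u : K -> R) (x y : K) : R :=
  N y `^ (- alpha - 1) * (u (x - y) - u x).

(* Rintegral has a default value on non-integrable functions, so existence of
   (D^alpha u)(x) is recorded separately. *)
Definition vladimirov_exists (u : K -> R) (x : K) : Prop :=
  mu.-integrable [set: borel K] (EFin \o vladimirov_integrand u x).

Definition vladimirov (u : K -> R) (x : K) : R :=
  theta * Rintegral mu [set: borel K] (vladimirov_integrand u x).

Definition Icoef : R :=
  if alpha == 1 then (1 - q%:R) / (q%:R * ln q%:R)
  else (1 - q%:R `^ (- alpha)) / (1 - q%:R `^ (alpha - 1)).

Definition Ikernel (r s : R) : R :=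
  if alpha == 1 then ln r - ln s else r `^ (alpha - 1) - s `^ (alpha - 1).

(* A radial function is represented by a map R -> R, of which only the values
   on q^Z and at 0 matter. *)
Definition Ialpha (phi : R -> R) (r : R) : R :=
  if r == 0 then 0 else
  q%:R `^ (- alpha) * r `^ alpha * phi r
  + Icoef * Rintegral mu [set y : K | N y < r]
                      (fun y : K => Ikernel r (N y) * phi (N y)).

Definition picard (f : R -> R -> R) (u0 : R) (k : nat) : R -> R :=
  iter k (fun (v : R -> R) r => u0 + Ialpha (fun s => f s (v s)) r) (fun=> u0).

Definition v0 (f : R -> R -> R) (u : R -> R) (l : int) : R :=
  Icoef * Rintegral mu [set y : K | N y <= q%:R ^ l]
    (fun y : K => Ikernel (q%:R ^ (l + 1)) (N y) * f (N y) (u (N y))).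

Definition continuation_equation (f : R -> R -> R) (u0 : R) (u : R -> R)
    (l : int) (v : R) : Prop :=
  v = u0 + v0 f u l + q%:R `^ (alpha * l%:~R) * f (q%:R ^ (l + 1)) v.

(* Under condition (ii) the continuation equation has exactly one solution v,
   so the second clause determines u (q ^ (l + 1)). *)
Definition constructed_mild_solution (f : R -> R -> R) (u0 : R) (u : R -> R)
    : Prop :=
  exists n : int,
    {uniform [set t : K | N t <= q%:R ^ n],
      (fun k (t : K) => picard f u0 k (N t)) @ \oo --> (fun t : K => u (N t))}
    /\ forall l : int, n <= l ->
         continuation_equation f u0 u l (u (q%:R ^ (l + 1))).

End Operators.

(* Main.v *)
Require Import Defs.
From mathcomp Require Import all_boot all_order all_algebra.
From mathcomp Require Import all_classical all_reals all_analysis.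
From mathcomp Require Import ring lra zify measurable_realfun.
Set Implicit Arguments.
Unset Strict Implicit.
Unset Printing Implicit Defensive.
Import Order.TTheory GRing.Theory Num.Theory numFieldNormedType.Exports.
Local Open Scope classical_set_scope.
Local Open Scope ring_scope.

(** Write A = q^alpha, rho = A / q, phi k = f (q^k, u (q^k)) and
psi k = A^k phi k. The spheres of K have measure q^n (1 - 1/q), so that on
radial functions both operators are sums over Z.

The coefficients of I^alpha have one form for all alpha: with
[j] = 1 + rho + ... + rho^(j-1), the coefficient of phi k in I^alpha phi at q^m
is - lambda A^k [m - k] for k < m, where lambda = (1 - 1/A) (1 - 1/q)
([Icoef_Ikernel]). Hence a mild solution satisfies, at every q^m,

  u (q^m) - u0 = psi m / A - lambda V m,   V m = sum_(k < m) [m - k] psi k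

([Ialpha_radial], [mild_solution_series]): on the small ball this is obtained
by passing to the limit in the iteration, and above it the continuation
equation is the integral equation itself.

Put T m = sum_(k < m) psi k. From [j + 1] = 1 + rho [j] come the recurrences
T (m + 1) = T m + psi m and V (m + 1) = rho V m + T (m + 1). They make
q^m (u (q^m) - u0) and A^(-m) (u (q^m) - u0) the increments of

  q^m (T m / A - (1 - 1/q) V m / A)   and   A^(-m) ((1 - 1/A) V m + T m / A),

so that the two series in D^alpha u (q^n) telescope ([inner_series],
[outer_series]), and the boundary terms at n add up to phi n
([vladimirov_Iradial]).

Convergence uses the two bounds on f separately. Boundedness gives
|psi k| <= M A^k, which makes T m and V m converge and be of order A^m at
-oo. At +oo, phi is summable by the decay of f, and A^(-m) T m and A^(-m) V m
are obtained from summable terms by the contracting recursions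
t (m + 1) = (t m + phi m) / A and y (m + 1) = y m / q + t (m + 1), hence are
summable too ([is_cvg_series_recursion]). *)

(** * Absolutely convergent real series *)

Section Series.
Context {R : realType}.
Implicit Types f g z e X : R^nat.

Definition abscvg f := cvgn (series (fun j => `|f j|)).
Definition tsum f : R := limn (series f).

Lemma abscvg_is_cvg f : abscvg f -> cvgn (series f).
Proof. exact: normed_cvg. Qed.

Lemma abscvg_cvg f : abscvg f -> series f @ \oo --> tsum f.
Proof. exact: abscvg_is_cvg. Qed.

Lemma cvg_tsum f (l : R) : series f @ \oo --> l -> tsum f = l.
Proof. by move=> /cvg_lim; exact. Qed.

Lemma abscvg_le f g : (forall j, `|f j| <= g j) -> cvgn (series g) -> abscvg f.
Proof.
move=> fg; apply: series_le_cvg => // n; exact: le_trans (fg n).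
Qed.

Lemma abscvgD f g : abscvg f -> abscvg g -> abscvg (fun j => f j + g j).
Proof.
move=> cf cg; apply: (@abscvg_le _ (fun j => `|f j| + `|g j|)) => [j|].
  exact: ler_normD.
exact: is_cvg_seriesD cf cg.
Qed.

Lemma abscvgZ c f : abscvg f -> abscvg (fun j => c * f j).
Proof.
move=> cf; apply: (@abscvg_le _ (fun j => `|c| * `|f j|)) => [j|].
  by rewrite normrM.
exact: is_cvg_seriesZ cf.
Qed.

Lemma tsumD f g : abscvg f -> abscvg g ->
  tsum (fun j => f j + g j) = tsum f + tsum g.
Proof. by move=> /abscvg_is_cvg cf /abscvg_is_cvg cg; rewrite /tsum -lim_seriesD. Qed.

Lemma tsumZ c f : abscvg f -> tsum (fun j => c * f j) = c * tsum f.
Proof. by move=> /abscvg_is_cvg cf; rewrite /tsum -[RHS]lim_seriesZ. Qed.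

Lemma abscvgS f : abscvg (fun j => f j.+1) -> abscvg f.
Proof.
move=> cf; apply/cvg_ex; exists (`|f 0%N| + limn (series (fun j => `|f j.+1|))).
rewrite -cvg_shiftS [X in X @ _](_ : _ =
  (fun n => `|f 0%N| + series (fun j => `|f j.+1|) n)).
  by apply: cvgD; [exact: cvg_cst|].
by apply/funext => n; rewrite seriesEnat/= big_nat_recl// seriesEnat.
Qed.

Lemma abscvg_shift f : abscvg f -> abscvg (fun j => f j.+1).
Proof.
move=> cf; apply/cvg_ex; exists (limn (series (fun j => `|f j|)) - `|f 0%N|).
rewrite [X in X @ _](_ : _ =
  (fun n => [sequence series (fun j => `|f j|) n.+1]_n n - `|f 0%N|)).
  by apply: cvgB; [rewrite cvg_shiftS | exact: cvg_cst].
by apply/funext => n; rewrite !seriesEnat/= big_nat_recl// addrC addKr.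
Qed.

Lemma tsum_recl f : abscvg (fun j => f j.+1) ->
  tsum f = f 0%N + tsum (fun j => f j.+1).
Proof.
move=> cf; apply: cvg_tsum; rewrite -cvg_shiftS [X in X @ _](_ : _ =
  (fun n => f 0%N + series (fun j => f j.+1) n)).
  by apply: cvgD; [exact: cvg_cst | exact: abscvg_cvg].
by apply/funext => n; rewrite seriesEnat/= big_nat_recl// seriesEnat.
Qed.

Lemma tsum_norm_le f g c : (forall j, `|f j| <= c * g j) -> cvgn (series g) ->
  `|tsum f| <= c * tsum g.
Proof.
move=> fg cg; have cg' := is_cvg_seriesZ (k := c) cg.
have cf := abscvg_le fg cg'.
apply: le_trans (lim_series_norm cf) _.
rewrite /tsum -[leRHS]lim_seriesZ//; exact: lim_series_le.
Qed.

(** Summing z (j + 1) <= r z j + e j bounds the partial sums S of z by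
z 0 + r S + sum e, that is, by (z 0 + sum e) / (1 - r). *)
Lemma is_cvg_series_recursion z e r : 0 <= r < 1 ->
  (forall j, 0 <= z j) -> (forall j, z j.+1 <= r * z j + e j) ->
  abscvg e -> cvgn (series z).
Proof.
move=> /andP[r0 r1] z0 ze ce.
have [B eB] : exists B, forall n, series (fun j => `|e j|) n <= B.
  have [B [_ hB]] := cvg_seq_bounded ce.
  exists (B + 1) => n; apply: le_trans (ler_norm _) _.
  by apply: hB => //; rewrite ltrDl.
apply: nondecreasing_is_cvgn; first by apply: nondecreasing_series.
exists ((z 0%N + B) / (1 - r)) => _ [n _ <-].
have zS m : series z m <= series z m.+1 by rewrite seriesSr lerDl.
rewrite ler_pdivlMr ?subr_gt0//.
suff : series z n.+1 <= z 0%N + (r * series z n + B) by have := zS n; nra.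
rewrite seriesEnat/= big_nat_recl// lerD2l.
apply: le_trans (_ : r * series z n + series (fun j => `|e j|) n <= _); last first.
  by rewrite lerD2l.
rewrite !seriesEnat/= mulr_sumr -big_split/=; apply: ler_sum => i _.
by apply: le_trans (ze i) _; rewrite lerD2l ler_norm.
Qed.

Lemma telescope_tsum f X : (forall j, f j = X j - X j.+1) ->
  X @ \oo --> (0 : R) -> tsum f = X 0%N.
Proof.
move=> fX X0; apply: cvg_tsum.
rewrite (_ : series f = fun n => X 0%N - X n); last first.
  apply/funext; elim=> [|n IH]; first by rewrite seriesEnat/= big_geq// subrr.
  by rewrite seriesSr IH fX addrA subrK.
by rewrite -[X in _ --> X]subr0; apply: cvgB => //; exact: cvg_cst.
Qed.

(** Absolute convergence of X gives both the convergence of the series of its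
increments and the vanishing of X at infinity. *)
Lemma abscvg_telescope f X : (forall j, f j = X j - X j.+1) -> abscvg X ->
  abscvg f /\ tsum f = X 0%N.
Proof.
move=> fX cX; split.
  rewrite (_ : f = fun j => X j + (-1) * X j.+1); last first.
    by apply/funext => j; rewrite fX mulN1r.
  by apply: abscvgD => //; apply: abscvgZ; exact: abscvg_shift.
apply: telescope_tsum => //; apply: cvg_series_cvg_0; exact: abscvg_is_cvg.
Qed.

Lemma is_cvg_geometric_inv (a c : R) : 1 < a -> cvgn (series (fun j => c * a ^- j)).
Proof.
move=> a1; rewrite (_ : (fun j => _) = geometric c a^-1).
  by apply: is_cvg_geometric_series; rewrite gtr0_norm ?invr_gt0 ?invf_lt1//; lra.
by apply/funext => j; rewrite /geometric/= exprVn.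
Qed.

End Series.

(** * The two operators as operators on sequences indexed by Z *)

Section Discrete.
Context {R : realType}.
Implicit Types (r : R) (psi : int -> R).

(** [geosum r j] is the r-analogue of the integer j, with value j at r = 1.
That value is what makes alpha = 1 an instance of the general computation. *)
Definition geosum r (j : nat) : R := \sum_(i < j) r ^+ i.

Lemma geosumS r j : geosum r j.+1 = 1 + r * geosum r j.
Proof.
rewrite /geosum big_ord_recl expr0 mulr_sumr; congr (_ + _).
by apply: eq_bigr => i _; rewrite exprS.
Qed.

Lemma geosum_ge0 r j : 0 <= r -> 0 <= geosum r j.
Proof. by move=> r0; apply: sumr_ge0 => i _; exact: exprn_ge0. Qed.

Lemma geosumS_ge1 r j : 0 <= r -> 1 <= geosum r j.+1.
Proof. by move=> r0; rewrite geosumS lerDl mulr_ge0// geosum_ge0. Qed.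

Lemma expfzB (a : R) (m : int) (j : nat) : a != 0 -> a ^ (m - j%:Z) = a ^ m * a ^- j.
Proof. by move=> a0; rewrite expfzDr// exprnN. Qed.

Lemma expfzDn (a : R) (m : int) (j : nat) : a != 0 -> a ^ (m + j%:Z) = a ^ m * a ^+ j.
Proof. by move=> a0; rewrite expfzDr// exprnP. Qed.

Variables (Q A : R).
Hypotheses (Q1 : 1 < Q) (A1 : 1 < A).
Let rho := A / Q.
Let Q0 : 0 < Q. Proof. exact: lt_trans ltr01 Q1. Qed.
Let A0 : 0 < A. Proof. exact: lt_trans ltr01 A1. Qed.
Let Qn0 : Q != 0. Proof. by rewrite gt_eqF. Qed.
Let An0 : A != 0. Proof. by rewrite gt_eqF. Qed.
Let rho0 : 0 <= rho. Proof. by rewrite divr_ge0// ltW. Qed.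

(** The dominating sequence for the sums below: [past_sum] and
[weighted_past_sum] at m are dominated termwise by a multiple of
A^m [geoweight j] as soon as psi k = O(A^k). *)
Definition geoweight (j : nat) : R := geosum rho j.+1 * A ^- j.+1.

(** [geosum rho j] may grow like rho^j or like j; the recursion
w (j + 1) = w j / Q + A^(-j-2) covers all cases at once. *)
Lemma cvg_geoweight : cvgn (series geoweight).
Proof.
have := is_cvg_geometric_inv (c := A^-1) A1.
set e := (X in series X) => ce.
apply: (@is_cvg_series_recursion _ _ (fun j => A^-1 * e j) Q^-1).
- by rewrite invr_ge0 ltW//= invf_lt1.
- by move=> j; rewrite mulr_ge0 ?geosum_ge0// invr_ge0 exprn_ge0// ltW.
- move=> j; rewrite /geoweight [X in X * _]geosumS mulrDl mul1r addrC lerD//.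
    have An : A ^+ j.+1 != 0 by rewrite expf_neq0.
    rewrite le_eqVlt; apply/orP; left; apply/eqP; rewrite [A ^+ j.+2]exprS /rho; field.
    by rewrite An Qn0 An0.
  by rewrite /e !exprS !invfM mulrA.
- apply: abscvgZ; apply: (@series_le_cvg _ _ e) => //.
  + by move=> n; rewrite mulr_ge0 ?invr_ge0 ?exprn_ge0// ltW.
  + by move=> n; rewrite ger0_norm// mulr_ge0 ?invr_ge0 ?exprn_ge0// ltW.
Qed.

Lemma tsum_geoweight_ge0 : 0 <= tsum geoweight.
Proof.
apply: limr_ge; first exact: cvg_geoweight.
apply: nearW => n; apply: sumr_ge0 => j _.
by rewrite mulr_ge0 ?geosum_ge0 ?invr_ge0 ?exprn_ge0// ltW.
Qed.

Definition past_sum psi (m : int) : R := tsum (fun j : nat => psi (m - j.+1%:Z)).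
Definition weighted_past_sum psi (m : int) : R :=
  tsum (fun j : nat => geosum rho j.+1 * psi (m - j.+1%:Z)).

(** The operator I^alpha on radial functions, for Q = q and A = q^alpha, when a
function phi on q^Z is encoded by psi k = A^k phi (q^k). *)
Definition Iradial psi (m : int) : R :=
  A^-1 * psi m - (1 - A^-1) * (1 - Q^-1) * weighted_past_sum psi m.

Section Bounded.
Variables (psi : int -> R) (M : R) (n : int).
Hypothesis psiM : forall k : int, k < n -> `|psi k| <= M * A ^ k.

Let qbound j (m : int) : m <= n ->
  `|geosum rho j.+1 * psi (m - j.+1%:Z)| <= M * A ^ m * geoweight j.
Proof.
move=> mn; rewrite normrM ger0_norm ?geosum_ge0// /geoweight mulrCA.
rewrite ler_wpM2l ?geosum_ge0//.
have jn : m - j.+1%:Z < n by apply: lt_le_trans mn; rewrite ltrBlDr ltrDl.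
by apply: le_trans (psiM jn) _; rewrite expfzB// mulrA.
Qed.

Let pbound j (m : int) : m <= n -> `|psi (m - j.+1%:Z)| <= M * A ^ m * geoweight j.
Proof.
move=> mn; apply: le_trans (qbound j mn); rewrite normrM ler_peMl//.
by apply: le_trans (ler_norm _); exact: geosumS_ge1.
Qed.

Lemma abscvg_past_sum (m : int) : m <= n -> abscvg (fun j : nat => psi (m - j.+1%:Z)).
Proof.
move=> mn; apply: (abscvg_le (fun j => pbound j mn)).
exact: (is_cvg_seriesZ (k := M * A ^ m) cvg_geoweight).
Qed.

Lemma abscvg_weighted_past_sum (m : int) : m <= n ->
  abscvg (fun j : nat => geosum rho j.+1 * psi (m - j.+1%:Z)).
Proof.
move=> mn; apply: (abscvg_le (fun j => qbound j mn)).
exact: (is_cvg_seriesZ (k := M * A ^ m) cvg_geoweight).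
Qed.

Lemma past_sum_le (m : int) : m <= n -> `|past_sum psi m| <= M * A ^ m * tsum geoweight.
Proof. by move=> mn; exact: tsum_norm_le (fun j => pbound j mn) cvg_geoweight. Qed.

Lemma weighted_past_sum_le (m : int) : m <= n ->
  `|weighted_past_sum psi m| <= M * A ^ m * tsum geoweight.
Proof. by move=> mn; exact: tsum_norm_le (fun j => qbound j mn) cvg_geoweight. Qed.

Let shiftS (m : int) (j : nat) : m + 1 - j.+1%:Z = m - j%:Z.
Proof. lia. Qed.

Lemma past_sumS (m : int) : m < n -> past_sum psi (m + 1) = past_sum psi m + psi m.
Proof.
move=> mn; rewrite /past_sum; under eq_fun do rewrite shiftS.
by rewrite tsum_recl ?subr0 1?addrC//; apply: abscvg_past_sum; exact: ltW.
Qed.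

Lemma weighted_past_sumS (m : int) : m < n ->
  weighted_past_sum psi (m + 1) = rho * weighted_past_sum psi m + past_sum psi (m + 1).
Proof.
move=> mn; rewrite past_sumS// /weighted_past_sum; under eq_fun do rewrite shiftS.
have cq := abscvg_weighted_past_sum (ltW mn); have cp := abscvg_past_sum (ltW mn).
rewrite tsum_recl/=; last first.
  under eq_fun do rewrite geosumS mulrDl mul1r -mulrA.
  by apply: abscvgD => //; exact: abscvgZ.
under eq_fun do rewrite geosumS mulrDl mul1r -mulrA.
rewrite tsumD//; last exact: abscvgZ.
by rewrite tsumZ// subr0 geosumS /geosum big_ord0 mulr0 addr0 mul1r /past_sum; ring.
Qed.

End Bounded.

(** The continuity estimate behind the passage to the limit in the iteration. *)
Lemma Iradial_dist psi psi' (M D : R) (m : int) :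
  (forall k : int, k < m -> `|psi k| <= M * A ^ k) ->
  (forall k : int, k < m -> `|psi' k| <= M * A ^ k) ->
  (forall k : int, k <= m -> `|psi k - psi' k| <= D * A ^ k) ->
  `|Iradial psi m - Iradial psi' m| <= D * (A ^ m * (A^-1 + tsum geoweight)).
Proof.
move=> psiM psiM' psiD.
have cq := abscvg_weighted_past_sum psiM (lexx m).
have cq' := abscvg_weighted_past_sum psiM' (lexx m).
have sumB : weighted_past_sum psi m - weighted_past_sum psi' m =
    weighted_past_sum (fun k => psi k - psi' k) m.
  rewrite /weighted_past_sum -mulN1r -tsumZ// -tsumD//; last exact: abscvgZ.
  by congr tsum; apply/funext => j; rewrite mulN1r mulrBr.
have -> : Iradial psi m - Iradial psi' m = A^-1 * (psi m - psi' m)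
    - (1 - A^-1) * (1 - Q^-1) * weighted_past_sum (fun k => psi k - psi' k) m.
  by rewrite -sumB /Iradial; ring.
have Di := psiD _ (lexx m).
have Dq := @weighted_past_sum_le _ D m (fun k km => psiD k (ltW km)) m (lexx m).
have -> : D * (A ^ m * (A^-1 + tsum geoweight)) =
  D * A ^ m * A^-1 + D * A ^ m * tsum geoweight by ring.
apply: le_trans (ler_normB _ _) _; apply: lerD.
  by rewrite normrM ger0_norm ?invr_ge0 ?(ltW A0)// mulrC ler_wpM2r// invr_ge0 ltW.
have l01 (a : R) : 1 < a -> 0 <= 1 - a^-1 <= 1.
  move=> a1; have a0 : 0 < a by exact: lt_trans ltr01 a1.
  by rewrite subr_ge0 gerBl invr_ge0 (ltW a0) invf_le1// ltW.
have /andP[a0 a1] := l01 _ A1; have /andP[q0 q1] := l01 _ Q1.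
apply: le_trans Dq; rewrite normrM ler_piMl// ger0_norm ?mulr_ge0//.
by rewrite mulr_ile1.
Qed.

Section Inversion.
Variables (psi : int -> R) (M : R) (n : int).
Hypothesis psiM : forall k : int, `|psi k| <= M * A ^ k.
Hypothesis psi_sum : abscvg (fun j : nat => A ^ (- (n + j%:Z)) * psi (n + j%:Z)).

Let v := Iradial psi.
Let P := past_sum psi.
Let V := weighted_past_sum psi.

Let PS (m : int) : P (m + 1) = P m + psi m.
Proof. by apply: (@past_sumS _ M (m + 1)) => //; rewrite ltrDl. Qed.

Let VS (m : int) : V (m + 1) = rho * V m + (P m + psi m).
Proof.
by rewrite -PS; apply: (@weighted_past_sumS _ M (m + 1)) => //; rewrite ltrDl.
Qed.

Let M0 : 0 <= M.
Proof. by have := le_trans (normr_ge0 _) (psiM 0); rewrite expr0z mulr1. Qed.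

Let Pe (j : nat) : `|P (n - j%:Z)| <= M * A ^ n * tsum geoweight.
Proof.
apply: le_trans (@past_sum_le _ M (n - j%:Z) (fun k _ => psiM k) _ (lexx _)) _.
rewrite ler_wpM2r ?tsum_geoweight_ge0// ler_wpM2l// expfzB//.
rewrite ler_piMr ?exprz_ge0//; first exact: ltW.
by rewrite invf_le1 ?exprn_gt0// exprn_ege1// ltW.
Qed.

Let Ve (j : nat) : `|V (n - j%:Z)| <= M * A ^ n * tsum geoweight.
Proof.
apply: le_trans (@weighted_past_sum_le _ M (n - j%:Z) (fun k _ => psiM k) _ (lexx _)) _.
rewrite ler_wpM2r ?tsum_geoweight_ge0// ler_wpM2l// expfzB//.
rewrite ler_piMr ?exprz_ge0//; first exact: ltW.
by rewrite invf_le1 ?exprn_gt0// exprn_ege1// ltW.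
Qed.

Let x : R := - (1 - Q^-1) / A.
(* The subtracted constant v n / (Q - 1) accounts for the terms - v n Q^m,
which are increments of - v n Q^m / (Q - 1). *)
Let inner (j : nat) : R := Q ^ (n - j%:Z) *
  (x * V (n - j%:Z) + A^-1 * P (n - j%:Z) - v n / (Q - 1)).

(** The contribution to D^alpha at q^n of the points nearer to the origin:
V m and T m are bounded for m <= n, so that Q^m V m and Q^m T m vanish at
-oo. *)
Lemma inner_series :
  abscvg (fun j : nat => Q ^ (n - j.+1%:Z) * (v (n - j.+1%:Z) - v n)) /\
  tsum (fun j : nat => Q ^ (n - j.+1%:Z) * (v (n - j.+1%:Z) - v n)) =
  Q ^ n * (x * V n + A^-1 * P n - v n / (Q - 1)).
Proof.
have -> : Q ^ n * (x * V n + A^-1 * P n - v n / (Q - 1)) = inner 0%N.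
  by rewrite /inner subr0.
apply: abscvg_telescope => [j|].
  rewrite /inner (_ : n - j%:Z = (n - j.+1%:Z) + 1); last by lia.
  move: (n - j.+1%:Z) => m.
  rewrite expfzDr// expr1z PS VS /x /v /Iradial -/V -/rho /rho.
  by field; rewrite subr_eq0 gt_eqF// Qn0.
pose B := M * A ^ n * tsum geoweight.
pose C := `|x| * B + `|A^-1| * B + `|v n / (Q - 1)|.
apply: (@abscvg_le _ _ (fun j : nat => Q ^ n * C * Q ^- j)).
  move=> j; rewrite /inner expfzB// normrM ger0_norm; last first.
    by rewrite mulr_ge0 ?exprz_ge0 ?invr_ge0 ?exprn_ge0// ltW.
  rewrite -[leRHS]mulrA [C * _]mulrC mulrA ler_wpM2l//.
    by rewrite mulr_ge0 ?exprz_ge0 ?invr_ge0 ?exprn_ge0// ltW.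
  apply: le_trans (ler_normB _ _) _; rewrite lerD2r.
  apply: le_trans (ler_normD _ _) _.
  by rewrite !normrM lerD// ler_wpM2l.
exact: is_cvg_geometric_inv.
Qed.

Let AS (m : int) : A ^ (- (m + 1)) = A ^ (- m) / A.
Proof. by rewrite opprD expfzDr// -invr_expz expr1z. Qed.

Let nS (j : nat) : n + j.+1%:Z = n + j%:Z + 1.
Proof. lia. Qed.

(* t (m + 1) = t m / A + A^(-m-1) psi m for t m = A^(-m) T m. *)
Let outer_P : abscvg (fun j : nat => A ^ (- (n + j%:Z)) * P (n + j%:Z)).
Proof.
apply: (@is_cvg_series_recursion _ _
  (fun j : nat => `|A^-1 * (A ^ (- (n + j%:Z)) * psi (n + j%:Z))|) A^-1) => //.
- by rewrite invr_ge0 ltW//= invf_lt1.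
- move=> j; rewrite nS; move: (n + _) => m; rewrite AS PS.
  rewrite -[X in X * `| _ |]ger0_norm ?invr_ge0 ?(ltW A0)// -normrM.
  by apply: le_trans (ler_normD _ _); rewrite -mulrDr -mulrDr mulrAC mulrC.
- by rewrite /abscvg; under eq_fun do rewrite normr_id; exact: abscvgZ.
Qed.

(* y (m + 1) = y m / Q + t (m + 1) for y m = A^(-m) V m. *)
Let outer_V : abscvg (fun j : nat => A ^ (- (n + j%:Z)) * V (n + j%:Z)).
Proof.
apply: (@is_cvg_series_recursion _ _
  (fun j : nat => `|A ^ (- (n + j.+1%:Z)) * P (n + j.+1%:Z)|) Q^-1) => //.
- by rewrite invr_ge0 ltW//= invf_lt1.
- move=> j; rewrite nS; move: (n + _) => m; rewrite VS -PS AS.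
  rewrite -[X in X * `| _ |]ger0_norm ?invr_ge0 ?(ltW Q0)// -normrM.
  apply: le_trans (ler_normD _ _); rewrite le_eqVlt; apply/orP; left; apply/eqP.
  by congr (`| _ |); rewrite /rho; field; rewrite An0.
- by rewrite /abscvg; under eq_fun do rewrite normr_id; exact: abscvg_shift outer_P.
Qed.

Let outer (j : nat) : R := - (A ^ (- (n + j.+1%:Z)) *
  ((1 - A^-1) * V (n + j.+1%:Z) + A^-1 * P (n + j.+1%:Z) + v n * (A / (A - 1)))).

(** The contribution to D^alpha at q^n of the points farther from the origin;
the boundary term at +oo vanishes since A^(-m) V m and A^(-m) T m are
summable. *)
Lemma outer_series :
  abscvg (fun j : nat => A ^ (- (n + j.+1%:Z)) * (v (n + j.+1%:Z) - v n)) /\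
  tsum (fun j : nat => A ^ (- (n + j.+1%:Z)) * (v (n + j.+1%:Z) - v n)) =
  - (A ^ (- n) / A * ((1 - A^-1) * (rho * V n + (P n + psi n))
     + A^-1 * (P n + psi n) + v n * (A / (A - 1)))).
Proof.
have -> : - (A ^ (- n) / A * ((1 - A^-1) * (rho * V n + (P n + psi n))
     + A^-1 * (P n + psi n) + v n * (A / (A - 1)))) = outer 0%N.
  by rewrite /outer VS PS AS.
apply: abscvg_telescope => [j|].
  rewrite /outer (_ : n + j.+2%:Z = (n + j.+1%:Z) + 1); last by lia.
  move: (n + j.+1%:Z) => m.
  rewrite AS PS VS /v /Iradial -/V /rho.
  by field; rewrite subr_eq0 gt_eqF// Qn0.
apply: (@abscvg_shift _ (fun j : nat => - (A ^ (- (n + j%:Z)) *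
  ((1 - A^-1) * V (n + j%:Z) + A^-1 * P (n + j%:Z) + v n * (A / (A - 1)))))).
pose c := A ^ (- n) * (v n * (A / (A - 1))).
rewrite (_ : (fun _ => _) = fun j : nat =>
  - (1 - A^-1) * (A ^ (- (n + j%:Z)) * V (n + j%:Z)) +
  (- A^-1 * (A ^ (- (n + j%:Z)) * P (n + j%:Z)) + (- c) * A ^- j)); last first.
  apply/funext => j; rewrite /c !opprD expfzDr// exprnN; ring.
apply: abscvgD; first exact: abscvgZ.
apply: abscvgD; first exact: abscvgZ.
apply: abscvgZ; apply: (@abscvg_le _ _ (fun j : nat => 1 * A ^- j)) => [j|].
  by rewrite mul1r ger0_norm// invr_ge0 exprn_ge0// ltW.
exact: is_cvg_geometric_inv.
Qed.

(** D^alpha I^alpha = id on Z-indexed sequences: once both series are replaced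
by their boundary terms at n, V n and T n cancel and only psi n is left. *)
Lemma vladimirov_Iradial :
  (1 - A) / (1 - A^-1 * Q^-1) * (1 - Q^-1) *
  ((A * Q) ^ (- n) *
     tsum (fun j : nat => Q ^ (n - j.+1%:Z) * (v (n - j.+1%:Z) - v n)) +
   tsum (fun j : nat => A ^ (- (n + j.+1%:Z)) * (v (n + j.+1%:Z) - v n))) =
  A ^ (- n) * psi n.
Proof.
rewrite (inner_series).2 (outer_series).2 expfzMl mulrA -[_ * _ ^ _ * _ ^ _]mulrA.
rewrite -expfzDr// addNr expr0z mulr1 /x /v /Iradial -/V /rho.
move: (A ^ _) => An.
by field; rewrite Qn0 An0 !subr_eq0 !gt_eqF// mulr_egt1// ltW.
Qed.

End Inversion.
End Discrete.

(** * Balls, spheres and integrals of radial functions *)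

Section Piecewise.
Context d (T : measurableType d) (R : realType) (mu : {measure set T -> \bar R}).

(** Measurability is automatic on a countable partition, so that integrability
and the value of the integral both reduce to a series. *)
Lemma integral_piecewise_constant (F : (set T)^nat) (c m : nat -> R) (h : T -> R) :
  trivIset setT F -> (forall j, measurable (F j)) ->
  (forall j, mu (F j) = (m j)%:E) -> (forall j x, F j x -> h x = c j) ->
  abscvg (fun j => c j * m j) ->
  mu.-integrable (\bigcup_j F j) (EFin \o h) /\
  Rintegral mu (\bigcup_j F j) h = tsum (fun j => c j * m j).
Proof.
move=> tF mF muF hc cc.
have m0 j : 0 <= m j by rewrite -lee_fin -muF.
have mh : measurable_fun (\bigcup_j F j) h.
  apply/measurable_fun_bigcup => // j.
  apply: (@eq_measurable_fun _ _ _ _ _ (cst (c j))) => [x /set_mem Fx|].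
    by rewrite /= (hc j).
  exact: measurable_cst.
have intF (e : R -> R) j : (\int[mu]_(x in F j) (e (h x))%:E = (e (c j) * m j)%:E)%E.
  rewrite (eq_integral (cst (e (c j))%:E)) => [|x /set_mem Fx]; last by rewrite /= (hc j).
  by rewrite integral_cst// muF EFinM.
have esum (f : nat -> R) : abscvg f -> (\sum_(j <oo) (f j)%:E = (tsum f)%:E)%E.
  move=> /abscvg_is_cvg cf; rewrite /tsum -EFin_lim//; apply: congr_lim.
  by apply/funext => n /=; rewrite seriesEnat/= sumEFin.
have ih : mu.-integrable (\bigcup_j F j) (EFin \o h).
  apply/integrableP; split; first exact/measurable_EFinP.
  rewrite ge0_integral_bigcup//; last first.
    by apply: measurableT_comp => //; exact/measurable_EFinP.
  rewrite (eq_eseriesr (g := fun j => (`|c j * m j|)%:E)) => [|j _].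
    rewrite esum ?ltry// /abscvg; under eq_fun do rewrite normr_id; exact: cc.
  under eq_integral do rewrite /= -/(Num.norm _).
  by rewrite (intF Num.norm) normrM (ger0_norm (m0 j)).
split => //.
rewrite /Rintegral integral_bigcup// (eq_eseriesr (g := fun j => (c j * m j)%:E)).
  by rewrite esum.
by move=> j _; exact: (intF id).
Qed.

Lemma integrable_disjoint_setU (A B : set T) (h : T -> \bar R) :
  measurable A -> measurable B -> [disjoint A & B] ->
  mu.-integrable A h -> mu.-integrable B h -> mu.-integrable (A `|` B) h.
Proof.
move=> mA mB AB /integrableP[hA iA] /integrableP[hB iB].
have hAB : measurable_fun (A `|` B) h by apply/measurable_funU.
apply/integrableP; split=> //.
rewrite ge0_integral_setU//; last by apply: measurableT_comp.
exact: lte_add_pinfty.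
Qed.

End Piecewise.

Section Balls.
Context {R : realType} {K : topologicalFieldType} {q : nat} {N : K -> R}.
Hypothesis hN : normalized_abs q N.

Lemma nabs1 : N 1 = 1.
Proof.
have N1 : N 1 != 0 by apply/eqP => /(nabs_eq0 hN)/eqP; rewrite oner_eq0.
by apply: (mulfI N1); rewrite -(nabs_mul hN) !mulr1.
Qed.

Lemma nabsN x : N (- x) = N x.
Proof.
suff N1 : N (-1) = 1 by rewrite -mulN1r (nabs_mul hN) N1 mul1r.
have : (N (-1) - 1) * (N (-1) + 1) = 0.
  rewrite (_ : _ * _ = N (-1) * N (-1) - 1); last by ring.
  by rewrite -(nabs_mul hN) mulrN1 opprK nabs1 subrr.
move/eqP; rewrite mulf_eq0 => /orP[|]; first by rewrite subr_eq0 => /eqP.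
by rewrite gt_eqF// ltr_wpDl// (nabs_ge0 hN).
Qed.

Lemma nabs_distC x y : N (x - y) = N (y - x).
Proof. by rewrite -nabsN opprB. Qed.

Lemma nabs_lt_trans x y z (r : R) : N (x - y) < r -> N (y - z) < r -> N (x - z) < r.
Proof.
move=> xy yz; rewrite -(subrK y x) -addrA; apply: le_lt_trans (nabs_ultra hN _ _) _.
by rewrite gt_max xy yz.
Qed.

Lemma nabs_gt0 x : (0 < N x) = (x != 0).
Proof.
rewrite lt_def (nabs_ge0 hN) andbT; congr (~~ _).
by apply/eqP/eqP => /(nabs_eq0 hN).
Qed.

Lemma nabs_eq_max x y : N x < N y -> N (x + y) = N y.
Proof.
move=> xy; apply/eqP; rewrite eq_le; apply/andP; split.
  by apply: le_trans (nabs_ultra hN _ _) _; rewrite ge_max lexx (ltW xy).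
have := nabs_ultra hN (- x) (x + y); rewrite addKr nabsN le_max.
by move=> /orP[|//]; rewrite leNgt xy.
Qed.

Lemma nabs_zpow x : x != 0 -> exists n : int, N x = q%:R ^ n.
Proof.
move=> x0; have : [set N x | x in [set x | x != 0]] (N x) by exists x.
by rewrite (nabs_values hN) => -[n _ <-]; exists n.
Qed.

Lemma ex_nabs_zpow (n : int) : exists2 x, x != 0 & N x = q%:R ^ n.
Proof.
have : [set q%:R ^ n | n in [set: int]] (q%:R ^ n : R) by exists n.
by rewrite -(nabs_values hN) => -[x x0 <-]; exists x.
Qed.

(** The counting of the residue field in the form used for measures: a
complete system of q elements of O, pairwise incongruent modulo P. *)
Lemma residue_representatives : exists rep : nat -> K,
  [/\ forall i, (i < q)%N -> N (rep i) <= 1,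
      forall x, N x <= 1 -> exists2 i, (i < q)%N & N (x - rep i) < 1 &
      forall i j, (i < q)%N -> (j < q)%N -> N (rep i - rep j) < 1 -> i = j].
Proof.
have := nabs_residue hN; rewrite card_eq_sym => /card_set_bijP[g [gF gI gS]].
have /choice[rep repP] i : exists x : K,
    (i < q)%N -> N x <= 1 /\ g i = [set y | N (y - x) < 1].
  case: (ltnP i q) => [iq|]; last by exists 0.
  by have [x x1 gx] := gF i iq; exists x.
exists rep; split=> [i /repP[]//|x x1|i j iq jq ij].
  have [|i iq gi] := gS [set y | N (y - x) < 1]; first by exists x.
  exists i => //; have [_] := repP i iq; rewrite gi => /seteqP[+ _].
  by move=> /(_ x); apply; rewrite /= subrr (nabs_eq0 hN _).2.
apply: gI; rewrite ?inE//.
have [_ ->] := repP i iq; have [_ ->] := repP j jq.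
apply/seteqP; split=> y /= yi.
  exact: nabs_lt_trans yi ij.
by apply: nabs_lt_trans yi _; rewrite nabs_distC.
Qed.

(** 0 and 1 lie in different cosets of P. *)
Lemma residue_card_gt1 : (1 < q)%N.
Proof.
have [rep [rep1 repE repI]] := residue_representatives.
have [|i iq Ni] := repE 1; first by rewrite nabs1.
have [|j jq Nj] := repE 0; first by rewrite (nabs_eq0 hN _).2.
rewrite ltnNge; apply/negP => q1.
have i0 : i = 0%N by move: iq q1; lia.
have j0 : j = 0%N by move: jq q1; lia.
rewrite {}i0 {}j0 in Ni Nj.
have := nabs_ultra hN (1 - rep 0) (- (0 - rep 0)).
by rewrite opprB subr0 subrK nabs1 leNgt gt_max Ni -nabsN -sub0r Nj.
Qed.

Let Q : R := q%:R.
Let Q1 : 1 < Q. Proof. by rewrite ltr1n residue_card_gt1. Qed.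
Let Q0 : 0 < Q. Proof. exact: lt_trans ltr01 Q1. Qed.

Definition oball (a : K) (n : int) : set (borel K) := [set y : K | N (y - a) < Q ^ n].
Definition sphere (a : K) (n : int) : set (borel K) := [set y : K | N (y - a) = Q ^ n].

Lemma oball_open a n : open (oball a n : set K).
Proof.
rewrite openE => x ax; apply/(nabs_nbhs hN); exists (Q ^ n); rewrite ?exprz_gt0//.
by move=> y /= yx; exact: nabs_lt_trans yx ax.
Qed.

Lemma measurable_oball a n : measurable (oball a n).
Proof. by apply: sub_sigma_algebra; exact: oball_open. Qed.

(** The value group is discrete, so that a closed ball is an open one. *)
Lemma le_oballE a (n : int) y : (N (y - a) <= Q ^ n) = (N (y - a) < Q ^ (n + 1)).
Proof.
case: (eqVneq (y - a) 0) => [->|/nabs_zpow[k ->]].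
  by rewrite (nabs_eq0 hN _).2// exprz_ge0 ?exprz_gt0// ltW.
by rewrite ler_eXz2l// ltr_eXz2l// ltzD1.
Qed.

Lemma sphereE a n : sphere a n = oball a (n + 1) `\` oball a n.
Proof.
apply/seteqP; split=> y /=; rewrite /sphere /oball/= -le_oballE.
  by move=> ->; rewrite ltxx.
by move=> [le /negP]; rewrite -leNgt => ge; apply/eqP; rewrite eq_le le.
Qed.

Lemma measurable_sphere a n : measurable (sphere a n).
Proof. by rewrite sphereE; apply: measurableD; exact: measurable_oball. Qed.

Variable mu : {measure set (borel K) -> \bar R}.
Hypothesis hmu : normalized_haar N mu.

Lemma mu_oball_center a n : mu (oball a n) = mu (oball 0 n).
Proof.
rewrite -(haar_invariant hmu a (measurable_oball 0 n)); congr (mu _).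
apply/seteqP; split=> y /=.
  by move=> ya; exists (y - a); rewrite ?/oball/= ?subr0// addrC subrK.
by move=> [z + <-]; rewrite /oball/= subr0 [a + z]addrC addrK.
Qed.

(** If N c = q^n, then c rep_0 + cP, ..., c rep_(q-1) + cP partition cO, and
these translates of cP have the same measure. *)
Lemma mu_oballS (n : int) :
  mu (oball 0 (n + 1)) = (q%:R%:E * mu (oball 0%R n))%E.
Proof.
have [rep [rep1 repE repI]] := residue_representatives.
have [c c0 cn] := ex_nabs_zpow n.
pose F (i : 'I_q) : set (borel K) := oball (c * rep i) n.
have -> : oball 0 (n + 1) = \big[setU/set0]_(i < q) F i.
  rewrite -(bigcup_mkord q (fun i => oball (c * rep i) n)).
  apply/seteqP; split=> y /=.
    rewrite {1}/oball/= -le_oballE subr0 => yn; have /repE[i iq Ni] : N (c^-1 * y) <= 1.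
      by rewrite -(ler_pM2l (_ : 0 < N c)) ?nabs_gt0// mulr1 -(nabs_mul hN) mulVKf// cn.
    exists i => //; rewrite /oball/= -(mulVKf c0 y) -mulrBr (nabs_mul hN) -/Q cn.
    by rewrite gtr_pMr// exprz_gt0.
  move=> [i /= /rep1 ri]; rewrite /oball/= -le_oballE subr0 => yi.
  rewrite -(subrK (c * rep i) y); apply: le_trans (nabs_ultra hN _ _) _.
  by rewrite ge_max (ltW yi) (nabs_mul hN) cn ler_piMr// exprz_ge0// ltW.
rewrite measure_bigsetU_ord//.
- rewrite (eq_bigr (fun=> mu (oball 0 n))) => [|i _]; last exact: mu_oball_center.
  by rewrite sumr_const card_ord [RHS]mule_natl.
- by move=> i; exact: measurable_oball.
- move=> i j _ _ [y [/= yi yj]]; apply/val_inj/repI; [exact: ltn_ord|exact: ltn_ord|].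
  have : N (c * rep i - c * rep j) < N c.
    by rewrite cn; apply: nabs_lt_trans yj; rewrite nabs_distC.
  by rewrite -mulrBr (nabs_mul hN) cn gtr_pMr ?exprz_gt0.
Qed.

Lemma mu_oball a n : mu (oball a n) = (Q ^ (n - 1))%:E.
Proof.
rewrite mu_oball_center.
have mu1 : mu (oball 0 1) = 1%E.
  rewrite -(haar_integers hmu); congr (mu _); apply/seteqP; split=> y /=.
    by rewrite /oball/= -[1 : int]add0r -le_oballE subr0 expr0z.
  by rewrite /oball/= -[1 : int]add0r -le_oballE subr0 expr0z.
have up (k : nat) : mu (oball 0 (1 + k%:Z)) = (Q ^ (1 + k%:Z - 1))%:E.
  elim: k => [|k IH]; first by rewrite addr0 mu1 subrr.
  have -> : 1 + k.+1%:Z = (1 + k%:Z) + 1 by lia.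
  rewrite mu_oballS IH -EFinM; congr (_%:E).
  rewrite (_ : 1 + k%:Z + 1 - 1 = 1 + (1 + k%:Z - 1)); last by lia.
  by rewrite [RHS]expfzDr ?gt_eqF// expr1z.
have down (k : nat) : mu (oball 0 (1 - k%:Z)) = (Q ^ (1 - k%:Z - 1))%:E.
  elim: k => [|k IH]; first by rewrite subr0 mu1 subrr.
  have := mu_oballS (1 - k.+1%:Z).
  have -> : 1 - k.+1%:Z + 1 = 1 - k%:Z by lia.
  rewrite IH; case: (mu _) => [r|/esym|/esym].
  - move=> /eqP; rewrite -EFinM eqe => /eqP /esym E; congr (_%:E).
    apply: (mulfI (_ : Q != 0)); first by rewrite gt_eqF.
    rewrite E (_ : 1 - k%:Z - 1 = 1 + (1 - k.+1%:Z - 1)); last by lia.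
    by rewrite expfzDr ?gt_eqF// expr1z.
  - by rewrite gt0_muley// lte_fin.
  - by rewrite gt0_muleNy// lte_fin.
have := up `|n - 1|%N; have := down `|n - 1|%N.
case: (leP 0 (n - 1)) => n1 + +.
  by move=> _; rewrite gez0_abs// (_ : 1 + (n - 1) = n); last by lia.
by rewrite ltz0_abs// (_ : 1 - - (n - 1) = n); last by lia.
Qed.

Lemma mu_sphere a n : mu (sphere a n) = (Q ^ n * (1 - Q^-1))%:E.
Proof.
have sub : oball a n `<=` oball a (n + 1).
  by move=> y /= yn; apply: lt_trans yn _; rewrite ltr_eXz2l// ltrDl.
have fin : (mu (oball a (n + 1)) < +oo)%E by rewrite mu_oball ltry.
have mA := measurable_oball a.
rewrite sphereE; transitivity (mu (oball a (n + 1)) - mu (oball a n))%E.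
  by rewrite (measureD (mA _) (mA _) fin) setIC (setIidl sub).
rewrite !mu_oball -EFinB; congr (_%:E).
by rewrite addrK expfzDr ?gt_eqF// mulrBr mulr1.
Qed.

Let zpow_inj : injective (fun k : int => Q ^ k).
Proof. by move=> i j /eqP; rewrite eq_le !ler_eXz2l// -eq_le => /eqP. Qed.

(** The centre is kept apart: a radial integrand can take any value there, but
it carries no mass. *)
Lemma oball_decomposition a n :
  oball a n = [set a] `|` \bigcup_j sphere a (n - j.+1%:Z).
Proof.
apply/seteqP; split=> y; rewrite /oball /sphere/=.
  case: (eqVneq y a) => [->|]; first by left.
  rewrite -subr_eq0 => /nabs_zpow[k Nk]; rewrite Nk ltr_eXz2l// => kn; right.
  exists (absz (n - k - 1)%R) => //=; rewrite Nk; congr (exprz _ _); lia.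
move=> [->|[j _ /= ->]]; first by rewrite subrr (nabs_eq0 hN _).2// exprz_gt0.
by rewrite ltr_eXz2l// ltrBlDr ltrDl.
Qed.

Lemma measurable_point a : measurable ([set a] : set (borel K)).
Proof.
rewrite (_ : [set a] = oball a 0 `\` \bigcup_j sphere a (0 - j.+1%:Z)).
  apply: measurableD; first exact: measurable_oball.
  by apply: bigcup_measurable => j _; exact: measurable_sphere.
rewrite oball_decomposition setDUl setDv setU0; apply/esym/setDidl/seteqP.
split=> // y [-> [j _]]; rewrite /sphere/= subrr (nabs_eq0 hN _).2//.
by move/esym/eqP; rewrite gt_eqF// exprz_gt0.
Qed.

(** A point lies in balls of measure q^(-k) for every k. *)
Lemma mu_point a : mu [set a] = 0%E.
Proof.
apply/eqP; rewrite eq_le measure_ge0 andbT.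
have le (k : nat) : (mu [set a] <= (Q ^- k)%:E)%E.
  apply: le_trans (_ : (mu (oball a (1 - k%:Z)) <= _)%E).
    apply: le_measure; rewrite ?inE; [exact: measurable_point|exact: measurable_oball|].
    by move=> _ ->; rewrite oball_decomposition; left.
  by rewrite mu_oball lee_fin addrAC subrr add0r exprnN.
have := le 0%N; have := measure_ge0 mu [set a].
case E : (mu [set a]) => [r| |] // _ _; rewrite lee_fin.
have {}cQ : geometric 1 Q^-1 @ \oo --> (0 : R).
  by apply: cvg_geometric; rewrite gtr0_norm ?invr_gt0// invf_lt1.
rewrite -(cvg_lim (@Rhausdorff R) cQ); apply: limr_ge; first exact/cvgP/cQ.
by apply: nearW => k; rewrite -lee_fin -E /geometric/= mul1r exprVn le.
Qed.

Lemma integral_oball a n (g : R -> R) (h : K -> R) :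
  (forall y, oball a n y -> h y = g (N (y - a))) ->
  abscvg (fun j : nat => g (Q ^ (n - j.+1%:Z)) * Q ^ (n - j.+1%:Z)) ->
  mu.-integrable (oball a n) (EFin \o h) /\
  Rintegral mu (oball a n) h =
    (1 - Q^-1) * tsum (fun j : nat => g (Q ^ (n - j.+1%:Z)) * Q ^ (n - j.+1%:Z)).
Proof.
move=> hg cg.
(* Index 0 holds the centre, with mass 0; the other pieces are the spheres. *)
pose F (j : nat) := if j is j.+1 then sphere a (n - j.+1%:Z) else [set a].
pose c (j : nat) := if j is j.+1 then g (Q ^ (n - j.+1%:Z)) else g 0.
pose m (j : nat) := if j is j.+1 then Q ^ (n - j.+1%:Z) * (1 - Q^-1) else 0.
have FE : oball a n = \bigcup_j F j.
  rewrite oball_decomposition; apply/seteqP; split=> y.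
    by move=> [->|[j _ yj]]; [exists 0%N|exists j.+1].
  by move=> [[|j] _ yj]; [left|right; exists j].
have cS : (fun j : nat => c j.+1 * m j.+1) =
    (fun j : nat => (1 - Q^-1) * (g (Q ^ (n - j.+1%:Z)) * Q ^ (n - j.+1%:Z))).
  by apply/funext => j /=; ring.
have cmS : abscvg (fun j : nat => c j.+1 * m j.+1) by rewrite cS; exact: abscvgZ.
have tF : trivIset setT F.
  apply/trivIsetP => -[|i] [|j] _ _ // ij; apply/seteqP; split=> // y [].
  - by move=> ->; rewrite /F /sphere/= subrr (nabs_eq0 hN _).2// => /esym/eqP;
      rewrite gt_eqF// exprz_gt0.
  - rewrite {1}/F /sphere/= => yF ya; move: yF.
    rewrite (_ : y = a)// subrr (nabs_eq0 hN _).2//.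
    by move=> /esym/eqP; rewrite gt_eqF// exprz_gt0.
  - rewrite /F /sphere/= => -> /zpow_inj; move/eqP: ij; lia.
have := @integral_piecewise_constant _ _ _ mu F c m h tF.
rewrite -FE tsum_recl// mulr0 add0r cS tsumZ//; apply.
- by move=> [|j]; [exact: measurable_point|exact: measurable_sphere].
- by move=> [|j]; [exact: mu_point|exact: mu_sphere].
- move=> j y yF; rewrite hg; last by rewrite FE; exists j.
  by case: j yF => [->|j ->] //=; rewrite subrr (nabs_eq0 hN _).2.
- exact: abscvgS.
Qed.

Lemma integral_oball_compl n (g : R -> R) (h : K -> R) :
  (forall y, Q ^ n < N y -> h y = g (N y)) ->
  abscvg (fun j : nat => g (Q ^ (n + j.+1%:Z)) * Q ^ (n + j.+1%:Z)) ->
  mu.-integrable (~` oball 0 (n + 1)) (EFin \o h) /\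
  Rintegral mu (~` oball 0 (n + 1)) h =
    (1 - Q^-1) * tsum (fun j : nat => g (Q ^ (n + j.+1%:Z)) * Q ^ (n + j.+1%:Z)).
Proof.
move=> hg cg.
have FE : ~` oball 0 (n + 1) = \bigcup_j sphere 0 (n + j.+1%:Z).
  apply/seteqP; split=> y /=; rewrite /oball/= -le_oballE.
    move=> /negP; rewrite -ltNge => yn; have y0 : y - 0 != 0.
      by rewrite -nabs_gt0; apply: lt_trans yn; rewrite exprz_gt0.
    have [k Nk] := nabs_zpow y0; move: yn; rewrite Nk ltr_eXz2l// => kn.
    exists (absz (k - n - 1)%R) => //; rewrite /sphere/= Nk; congr (exprz _ _); lia.
  by move=> [j _ /= ->]; apply/negP; rewrite -ltNge ltr_eXz2l// ltrDl.
have cS : (fun j : nat => g (Q ^ (n + j.+1%:Z)) * (Q ^ (n + j.+1%:Z) * (1 - Q^-1))) =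
    (fun j : nat => (1 - Q^-1) * (g (Q ^ (n + j.+1%:Z)) * Q ^ (n + j.+1%:Z))).
  by apply/funext => j /=; ring.
have tF : trivIset setT (fun j : nat => sphere 0 (n + j.+1%:Z)).
  apply/trivIsetP => i j _ _ ij; apply/seteqP; split=> // y [].
  by rewrite /sphere/= => -> /zpow_inj; move/eqP: ij; lia.
have := @integral_piecewise_constant _ _ _ mu _ (fun j : nat => g (Q ^ (n + j.+1%:Z)))
  (fun j : nat => Q ^ (n + j.+1%:Z) * (1 - Q^-1)) h tF.
rewrite -FE cS tsumZ//; apply.
- by move=> j; exact: measurable_sphere.
- by move=> j; exact: mu_sphere.
- move=> j y; rewrite /sphere/= subr0 => yF; rewrite hg yF//.
  by rewrite ltr_eXz2l// ltrDl.
- exact: abscvgZ.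
Qed.

End Balls.

(** * The mild solution and its Vladimirov derivative *)

Lemma powR_gt1 (R : realType) (a b : R) : 1 < a -> 0 < b -> 1 < a `^ b.
Proof.
move=> a1 b0; rewrite -(powRr0 a) /powR gt_eqF ?(lt_trans ltr01)//.
by rewrite ltr_expR ltr_pM2r ?ln_gt0.
Qed.

Section Radial.
Context {R : realType} {K : topologicalFieldType} {q : nat} {N : K -> R}.
Variables (mu : {measure set (borel K) -> \bar R}) (alpha : R).
Hypotheses (hN : normalized_abs q N) (hmu : normalized_haar N mu).
Hypothesis alpha0 : 0 < alpha.

Let Q : R := q%:R.
Let A : R := Q `^ alpha.
Let rho := A / Q.
Let Q1 : 1 < Q. Proof. by rewrite ltr1n (residue_card_gt1 hN). Qed.
Let Q0 : 0 < Q. Proof. exact: lt_trans ltr01 Q1. Qed.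
Let Qn0 : Q != 0. Proof. by rewrite gt_eqF. Qed.

Let A1 : 1 < A. Proof. exact: powR_gt1. Qed.
Let A0 : 0 < A. Proof. exact: lt_trans ltr01 A1. Qed.
Let An0 : A != 0. Proof. by rewrite gt_eqF. Qed.

Lemma powR_zpow (b : R) (k : int) : (Q ^ k) `^ b = (Q `^ b) ^ k.
Proof. by rewrite -!powR_intmul ?powR_ge0 ?ltW// -!powRrM mulrC. Qed.

Let powA1 : Q `^ (alpha - 1) = rho.
Proof. by rewrite powRB ?Qn0 ?implybT// powRr1// ltW. Qed.

Let powNA1 : Q `^ (- alpha - 1) = A^-1 * Q^-1.
Proof. by rewrite powRB ?Qn0 ?implybT// powRr1 ?ltW// powRN. Qed.

(** The normalizing constant and the kernel of I^alpha vary with alpha in such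
a way that their product is the same expression in A and rho for alpha <> 1,
where rho^m - rho^(m-j) = rho^(m-j) (rho - 1) [j], and for alpha = 1, where
log q^m - log q^(m-j) = j log q and rho = 1. *)
Lemma Icoef_Ikernel (m : int) (j : nat) :
  Icoef q alpha * (1 - Q^-1) * (Ikernel alpha (Q ^ m) (Q ^ (m - j%:Z)) * Q ^ (m - j%:Z))
  = - ((1 - A^-1) * (1 - Q^-1)) * (geosum rho j * A ^ (m - j%:Z)).
Proof.
rewrite /Icoef /Ikernel -/Q; case: eqP => [a1|/eqP a1].
  have AQ : A = Q by rewrite /A a1 powRr1// ltW.
  have -> : geosum rho j = j%:R.
    rewrite /rho AQ divff// /geosum; under eq_bigr do rewrite expr1n.
    by rewrite sumr_const card_ord.
  have lnQ (k : int) : ln (Q ^ k) = k%:~R * ln Q.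
    by rewrite -powR_intmul ?ln_powR// ltW.
  have lnQ0 : ln Q != 0 by rewrite gt_eqF// ln_gt0.
  rewrite !lnQ -mulrBl -rmorphB/= opprB addrCA subrr addr0 AQ.
  by rewrite -pmulrn; field; rewrite Qn0.
have rho1 : rho != 1.
  rewrite -powA1; case: (ltgtP alpha 1) a1 => // al _.
    have : 1 < Q `^ (1 - alpha) by rewrite powR_gt1 ?subr_gt0.
    by rewrite -opprB powRN; apply: contraTneq => ->; rewrite invr1 ltxx.
  by rewrite gt_eqF// powR_gt1 ?subr_gt0.
rewrite powA1 !powR_zpow powA1 powRN -/A.
have rhon0 : rho != 0 by rewrite mulf_neq0// invr_eq0.
have -> : rho ^ m = rho ^ (m - j%:Z) * rho ^+ j by rewrite -expfzDn// subrK.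
have -> : A ^ (m - j%:Z) = rho ^ (m - j%:Z) * Q ^ (m - j%:Z).
  by rewrite -expfzMl divfK.
have qn : rho ^+ j = (rho - 1) * geosum rho j + 1 by rewrite -subrX1 subrK.
rewrite qn; move: (rho ^ _) (Q ^ _) (geosum _ _) => x y z.
by field; rewrite -/Q Qn0 An0 subr_eq0 eq_sym rho1.
Qed.

Lemma Ialpha_radial (phi : R -> R) (M : R) (m : int) :
  (forall k : int, k < m -> `|phi (Q ^ k)| <= M) ->
  Ialpha q N mu alpha phi (Q ^ m) = Iradial Q A (fun k => A ^ k * phi (Q ^ k)) m.
Proof.
move=> phiM; rewrite /Ialpha gt_eqF ?exprz_gt0// powRN powR_zpow -/A -mulrA.
rewrite /Iradial; congr (_ + _).
have psiM (k : int) : k < m -> `|A ^ k * phi (Q ^ k)| <= M * A ^ k.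
  move=> km; rewrite normrM [`|A ^ k|]gtr0_norm ?exprz_gt0// [leRHS]mulrC.
  by rewrite ler_pM2l ?exprz_gt0// phiM.
have cq := abscvg_weighted_past_sum Q1 A1 psiM (lexx m).
pose c := Icoef q alpha * (1 - Q^-1); pose lam := (1 - A^-1) * (1 - Q^-1).
have lam0 : lam != 0.
  by rewrite mulf_neq0// subr_eq0 eq_sym invr_eq1 gt_eqF.
(* Icoef is nonzero because its product with a value of the kernel is. *)
have c0 : c != 0.
  have := Icoef_Ikernel m 1; rewrite -/c geosumS /geosum big_ord0 mulr0 addr0 mul1r.
  apply: contraPneq => ->; rewrite mul0r => /esym/eqP; apply/negP.
  by rewrite mulf_neq0 ?oppr_eq0 ?expfz_neq0.
pose g s := Ikernel alpha (Q ^ m) s * phi s.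
have E : (fun j : nat => g (Q ^ (m - j.+1%:Z)) * Q ^ (m - j.+1%:Z)) =
    (fun j : nat => - (c^-1 * lam) *
      (geosum rho j.+1 * (A ^ (m - j.+1%:Z) * phi (Q ^ (m - j.+1%:Z))))).
  apply/funext => j; apply: (mulfI c0); rewrite /g.
  set r := Q ^ (m - j.+1%:Z).
  transitivity (c * (Ikernel alpha (Q ^ m) r * r) * phi r); first by ring.
  by rewrite /c Icoef_Ikernel -/c -/lam; field.
have [||_ ] := @integral_oball R K q N hN mu hmu 0 m g (fun y => g (N y)).
- by move=> y _; rewrite subr0.
- by rewrite E; exact: abscvgZ.
rewrite -/Q E tsumZ// => I.
rewrite (_ : [set y : K | N y < Q ^ m] = @oball R K q N 0 m); last first.
  by apply/seteqP; split=> y; rewrite /oball/= subr0.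
rewrite I -/lam mulrA -/c [RHS]/= /weighted_past_sum -/rho.
by move: (tsum _) => T; field.
Qed.

Section MildSolution.
Variables (u0 : R) (f : R -> R -> R) (u : R -> R) (M F : R).
Hypothesis F0 : 0 < F.
Hypothesis fM : forall (k : int) (x : R), `|f (Q ^ k) x| <= M.
Hypothesis fF : forall (k : int) (x y : R),
  `|f (Q ^ k) x - f (Q ^ k) y| <= F * `|x - y|.
Hypothesis hu : constructed_mild_solution q N mu alpha f u0 u.

Let psi (v : R -> R) (k : int) : R := A ^ k * f (Q ^ k) (v (Q ^ k)).

Let psi_le v k : `|psi v k| <= M * A ^ k.
Proof.
rewrite normrM [`|A ^ k|]gtr0_norm ?exprz_gt0// [leRHS]mulrC.
by rewrite ler_pM2l ?exprz_gt0.
Qed.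

(** On the initial ball the iteration passes to the limit, with the error
controlled by [Iradial_dist]; beyond it the continuation equation applies. *)
Lemma mild_solution_series (m : int) : u (Q ^ m) = u0 + Iradial Q A (psi u) m.
Proof.
have [n [unif cont]] := hu.
have Iq (v : R -> R) k : Ialpha q N mu alpha (fun s => f s (v s)) (Q ^ k) =
    Iradial Q A (psi v) k.
  by apply: (@Ialpha_radial _ M).
case: (leP m n) => [mn|nm]; last first.
  (* Since {N y <= q^(m-1)} = {N y < q^m} and q^(alpha (m-1)) = A^(-1) A^m,
     the continuation equation at m - 1 is the integral equation at q^m. *)
  have := cont (m - 1) (_ : n <= m - 1); rewrite /continuation_equation -/Q subrK.
  have {}nm : n <= m - 1 by lia.
  move=> /(_ nm) ->; rewrite -Iq /Ialpha gt_eqF ?exprz_gt0// /v0 -addrA; congr (_ + _).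
  rewrite [RHS]addrC -/Q subrK; congr (_ + _).
    congr (_ * Rintegral _ _ _); apply/seteqP; split=> y /=.
      by rewrite -[y]subr0 (le_oballE hN) subrK.
    by rewrite -{2}[y]subr0 (le_oballE hN) subrK subr0.
  congr (_ * _); rewrite powR_zpow powRN -/A powRrM -/A powR_intmul ?ltW//.
  by rewrite expfzDr// mulrC exprN1.
pose C := A ^ m * (A^-1 + tsum (geoweight Q A)).
have C0 : 0 <= C.
  by rewrite mulr_ge0 ?addr_ge0 ?invr_ge0 ?exprz_ge0 ?tsum_geoweight_ge0 ?(ltW A0).
apply/eqP; rewrite -subr_eq0 -normr_le0; apply/ler_addgt0Pl => e e0; rewrite addr0.
(* If u is within d of the k-th and the (k+1)-st iterates, the defect of u in
the integral equation is at most d + F d C. *)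
pose d := e / (1 + F * C).
have d0 : 0 < d by rewrite divr_gt0// ltr_pwDl// mulr_ge0// ltW.
have near_d : \forall k \near \oo, forall t, N t <= Q ^ n ->
    `|u (N t) - picard q N mu alpha f u0 k (N t)| < d.
  apply: (unif [set h : K -> R | forall t, N t <= Q ^ n -> `|u (N t) - h t| < d]).
  apply/uniform_nbhs; exists [set xy : R * R | `|xy.1 - xy.2| < d].
  by split; [exact: entourage_ball (PosNum d0)|].
have {}near_d : \forall k \near \oo, forall j : int, j <= n ->
    `|u (Q ^ j) - picard q N mu alpha f u0 k (Q ^ j)| < d.
  apply: filterS near_d => k kd j jn; have [t _ tj] := ex_nabs_zpow hN j.
  by have := kd t; rewrite tj; apply; rewrite ler_eXz2l.
have [k _ kd] := near_d.
pose p := picard q N mu alpha f u0 k.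
have := kd k.+1 (leqnSn k) _ mn; rewrite /picard iterS -/(picard _ _ _ _ _ _ k).
rewrite -/p Iq => uS.
have := @Iradial_dist _ Q A Q1 A1 (psi p) (psi u) M (F * d) m
  (fun j _ => psi_le p j) (fun j _ => psi_le u j).
rewrite -/C => /(_ _) pu.
have {}pu : `|Iradial Q A (psi p) m - Iradial Q A (psi u) m| <= F * d * C.
  apply: pu => j jm; rewrite -mulrBr normrM gtr0_norm ?exprz_gt0// mulrC.
  rewrite ler_pM2r ?exprz_gt0//; apply: le_trans (fF _ _ _) _.
  rewrite ler_pM2l// distrC; apply/ltW/(kd k) => //=; exact: le_trans jm mn.
have -> : u (Q ^ m) - (u0 + Iradial Q A (psi u) m) =
  (u (Q ^ m) - (u0 + Iradial Q A (psi p) m)) +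
  (Iradial Q A (psi p) m - Iradial Q A (psi u) m) by ring.
apply: le_trans (ler_normD _ _) _.
apply: le_trans (lerD (ltW uS) pu) _.
rewrite (_ : d + F * d * C = d * (1 + F * C)); last by ring.
by rewrite /d divfK// gt_eqF// ltr_pwDl// mulr_ge0// ltW.
Qed.

End MildSolution.

Section Vladimirov.
Variables (w : R -> R) (t : K) (n : int).
Hypothesis tn : N t = Q ^ n.
Hypothesis inner_cvg : abscvg (fun j : nat =>
  Q ^ (n - j.+1%:Z) * (w (Q ^ (n - j.+1%:Z)) - w (Q ^ n))).
Hypothesis outer_cvg : abscvg (fun j : nat =>
  A ^ (- (n + j.+1%:Z)) * (w (Q ^ (n + j.+1%:Z)) - w (Q ^ n))).

Let h := vladimirov_integrand N alpha (fun x => w (N x)) t.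
Let near_t := @oball R K q N t n.
Let far := ~` @oball R K q N 0 (n + 1).

Let near_integral : mu.-integrable near_t (EFin \o h) /\
  Rintegral mu near_t h = (1 - Q^-1) * ((A * Q) ^ (- n) *
    tsum (fun j : nat => Q ^ (n - j.+1%:Z) * (w (Q ^ (n - j.+1%:Z)) - w (Q ^ n)))).
Proof.
pose g r := (A * Q) ^ (- n) * (w r - w (Q ^ n)).
have E : (fun j : nat => g (Q ^ (n - j.+1%:Z)) * Q ^ (n - j.+1%:Z)) =
    (fun j : nat => (A * Q) ^ (- n) *
      (Q ^ (n - j.+1%:Z) * (w (Q ^ (n - j.+1%:Z)) - w (Q ^ n)))).
  by apply/funext => j; rewrite /g; ring.
have [||] := @integral_oball R K q N hN mu hmu t n g h.
- move=> y; rewrite /oball/= => yt.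
  have Ny : N y = Q ^ n.
    by rewrite -(subrK t y) (nabs_eq_max hN) tn.
  rewrite /h /vladimirov_integrand /g Ny tn powR_zpow powNA1 (nabs_distC hN).
  by rewrite -invfM exprz_inv.
- by rewrite E; exact: abscvgZ.
by rewrite -/Q E tsumZ.
Qed.

Let far_integral : mu.-integrable far (EFin \o h) /\
  Rintegral mu far h = (1 - Q^-1) *
    tsum (fun j : nat => A ^ (- (n + j.+1%:Z)) * (w (Q ^ (n + j.+1%:Z)) - w (Q ^ n))).
Proof.
pose g r := r `^ (- alpha - 1) * (w r - w (Q ^ n)).
have E : (fun j : nat => g (Q ^ (n + j.+1%:Z)) * Q ^ (n + j.+1%:Z)) =
    (fun j : nat => A ^ (- (n + j.+1%:Z)) * (w (Q ^ (n + j.+1%:Z)) - w (Q ^ n))).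
  apply/funext => j; move: (n + j.+1%:Z) => l.
  rewrite /g powR_zpow powNA1 expfzMl !exprz_inv mulrAC; congr (_ * _).
  by rewrite -mulrA -expfzDr// addNr expr0z mulr1.
have [||] := @integral_oball_compl R K q N hN mu hmu n g h.
- move=> y yn.
  have Nty : N (t - y) = N y by rewrite -(nabsN hN y) (nabs_eq_max hN)// tn (nabsN hN).
  by rewrite /h /vladimirov_integrand /g Nty tn.
- by rewrite E.
by rewrite -/Q E.
Qed.

Let rest := ~` (near_t `|` far).

(* There N (t - y) = N t. *)
Let rest0 y : rest y -> h y = 0.
Proof.
rewrite /rest setCU setCK => -[/= /negP]; rewrite -leNgt /oball/= => ty.
rewrite -(le_oballE hN) subr0 => yn.
rewrite /h /vladimirov_integrand (_ : N (t - y) = N t) ?subrr ?mulr0//.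
apply/eqP; rewrite eq_le tn -{2}(nabs_distC hN) ty andbT.
by apply: le_trans (nabs_ultra hN _ _) _; rewrite ge_max tn lexx (nabsN hN).
Qed.

(** At a point t with N t = q^n the integrand of D^alpha is constant on the
spheres around t inside {N (y - t) < q^n} and on the spheres around 0 inside
{N y > q^n}, and it vanishes on the rest of K. *)
Lemma vladimirov_radial :
  vladimirov_exists N mu alpha (fun x => w (N x)) t /\
  vladimirov q N mu alpha (fun x => w (N x)) t =
  (1 - A) / (1 - A^-1 * Q^-1) * (1 - Q^-1) *
  ((A * Q) ^ (- n) *
     tsum (fun j : nat => Q ^ (n - j.+1%:Z) * (w (Q ^ (n - j.+1%:Z)) - w (Q ^ n))) +
   tsum (fun j : nat => A ^ (- (n + j.+1%:Z)) * (w (Q ^ (n + j.+1%:Z)) - w (Q ^ n)))).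
Proof.
have [i1 I1] := near_integral; have [i2 I2] := far_integral.
have m1 : measurable near_t by exact: measurable_oball.
have m2 : measurable far by apply: measurableC; exact: measurable_oball.
have m12 : measurable (near_t `|` far) by exact: measurableU.
have m3 : measurable rest by exact: measurableC.
have d12 : [disjoint near_t & far].
  apply/disj_setPCl => y; rewrite /near_t /oball/= -(le_oballE hN) subr0 => yt.
  by rewrite -(subrK t y) (nabs_eq_max hN) tn.
have d3 : [disjoint near_t `|` far & rest] by exact/disj_setPCl.
have i3 : mu.-integrable rest (EFin \o h).
  apply: (eq_integrable _ (cst 0%E)) => // [y|]; last exact: integrable0.
  by rewrite inE => /rest0 /= ->.
have I3 : Rintegral mu rest h = 0.
  rewrite (@eq_Rintegral _ _ _ _ _ (cst 0)) => [|y].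
    by rewrite /Rintegral integral0.
  by rewrite inE => /rest0.
have i12 := integrable_disjoint_setU m1 m2 d12 i1 i2.
have iT := integrable_disjoint_setU m12 m3 d3 i12 i3.
have TE : [set: borel K] = (near_t `|` far) `|` rest by rewrite setUv.
split; first by rewrite /vladimirov_exists TE.
rewrite /vladimirov TE Rintegral_setU// Rintegral_setU// I1 I2 I3 /theta -/Q -/A powNA1.
by ring.
Qed.

End Vladimirov.

End Radial.

Theorem theorem3 (R : realType) (K : topologicalFieldType) (q : nat)
    (N : K -> R) (mu : {measure set (borel K) -> \bar R})
    (alpha u0 : R) (f : R -> R -> R)
    (hK : nonarch_local_field K)
    (hN : normalized_abs q N)
    (hmu : normalized_haar N mu)
    (halpha : 0 < alpha)
    (hi : exists M F : R, [/\ 0 < M, 0 < F &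
      forall (t : K) (x y : R), t != 0 ->
        `|f (N t) x| <= M /\ `|f (N t) x - f (N t) y| <= F * `|x - y|])
    (hii : exists Fl : int -> R, forall l : int,
      0 < Fl l < q%:R `^ (- alpha * l%:~R) /\
      forall x y : R,
        `|f (q%:R ^ l) x - f (q%:R ^ l) y| <= Fl l * `|x - y|)
    (hiii : exists C beta : R, [/\ 0 < C, alpha < beta &
      forall (l : int) (x : R), 1 <= l ->
        `|f (q%:R ^ l) x| <= C * q%:R `^ (- beta * l%:~R)])
    (u : R -> R)
    (hu : constructed_mild_solution q N mu alpha f u0 u) :
  forall t : K, t != 0 ->
    vladimirov_exists N mu alpha (fun x => u (N x)) t /\
    vladimirov q N mu alpha (fun x => u (N x)) t = f (N t) (u (N t)).
Proof.
move=> t t0; have [n tn] := nabs_zpow hN t0.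
have [M [F [M0 F0 hfi]]] := hi; have [C [beta [C0 ab hfC]]] := hiii.
have fM (k : int) x : `|f (q%:R ^ k) x| <= M.
  by have [s s0 <-] := ex_nabs_zpow hN k; exact: (hfi s x x s0).1.
have fF (k : int) x y : `|f (q%:R ^ k) x - f (q%:R ^ k) y| <= F * `|x - y|.
  by have [s s0 <-] := ex_nabs_zpow hN k; exact: (hfi s x y s0).2.
have Q1 : 1 < q%:R :> R by rewrite ltr1n (residue_card_gt1 hN).
have A1 : 1 < q%:R `^ alpha :> R by exact: powR_gt1.
have A0 : 0 < q%:R `^ alpha :> R by exact: lt_trans ltr01 A1.
have B1 : 1 < q%:R `^ beta :> R by apply: powR_gt1 => //; exact: lt_trans ab.
have B0 : 0 < q%:R `^ beta :> R by exact: lt_trans ltr01 B1.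
pose psi (k : int) : R := (q%:R `^ alpha) ^ k * f (q%:R ^ k) (u (q%:R ^ k)).
have psiM k : `|psi k| <= M * (q%:R `^ alpha) ^ k.
  rewrite normrM [`|_ ^ k|]gtr0_norm ?exprz_gt0// [leRHS]mulrC.
  by rewrite ler_pM2l ?exprz_gt0.
(* One exponential bound for all k: for k < 1 the factor q^(- beta k) is at
least 1. *)
have decay (k : int) x : `|f (q%:R ^ k) x| <= (M + C) * (q%:R `^ beta) ^ (- k).
  case: (leP 1 k) => k1.
    apply: le_trans (hfC k x k1) _; rewrite mulNr -mulrN -intrN powRrM.
    rewrite powR_intmul ?powR_ge0//.
    by rewrite ler_pM2r ?exprz_gt0// lerDr ltW.
  apply: le_trans (fM k x) _; apply: (@le_trans _ _ (M + C)).
    by rewrite lerDl ltW.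
  rewrite ler_peMr ?addr_ge0 ?(ltW M0) ?(ltW C0)//.
  by rewrite -[leLHS](expr0z (q%:R `^ beta)) ler_eXz2l//; lia.
have psiS : abscvg (fun j : nat => (q%:R `^ alpha) ^ (- (n + j%:Z)) * psi (n + j%:Z)).
  apply: (@abscvg_le _ _ (fun j : nat =>
    (M + C) * (q%:R `^ beta) ^ (- n) * (q%:R `^ beta) ^- j)).
    move=> j; rewrite /psi mulrA -expfzDr ?gt_eqF// addNr expr0z mul1r.
    by apply: le_trans (decay _ _) _; rewrite opprD expfzDr ?gt_eqF// -exprnN mulrA.
  exact: is_cvg_geometric_inv.
have uE m : u (q%:R ^ m) = u0 + Iradial q%:R (q%:R `^ alpha) psi m.
  exact: (mild_solution_series hN hmu halpha F0 fM fF hu).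
have uB m m' : u (q%:R ^ m) - u (q%:R ^ m') =
    Iradial q%:R (q%:R `^ alpha) psi m - Iradial q%:R (q%:R `^ alpha) psi m'.
  by rewrite !uE; ring.
have [inner_cvg _] := inner_series Q1 A1 n psiM.
have [outer_cvg _] := outer_series Q1 A1 psiM psiS.
have innerE := funext (fun j : nat => congr1 (fun x => q%:R ^ (n - j.+1%:Z) * x)
  (uB (n - j.+1%:Z) n)).
have outerE := funext (fun j : nat =>
  congr1 (fun x => (q%:R `^ alpha) ^ (- (n + j.+1%:Z)) * x) (uB (n + j.+1%:Z) n)).
have [||ex ->] := @vladimirov_radial R K q N mu alpha hN hmu u t n tn.
- by rewrite innerE.
- by rewrite outerE.
split=> //; rewrite innerE outerE (vladimirov_Iradial Q1 A1 psiM psiS) tn.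
by rewrite /psi mulrA -expfzDr ?gt_eqF// addNr expr0z mul1r.
Qed.
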